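(* Let $\mathcal{M}=(T,S,P,Q,\langle,\rangle_T,\langle,\rangle_S)$ be a unital Morita context, let $\mathcal{A}$ and $\mathcal{B}$ be the categories of left $T$-modules and left $S$-modules respectively, and let $\mathcal{W}_r(\mathcal{M})=(G,\mathcal{A},\mathcal{B},F,\eta,\rho)$ be the induced right wide Morita context. (1) If $\mathcal{W}_r(\mathcal{M})$ is an injective right wide Morita context, then $\mathcal{M}$ is an injective Morita context. (2) If $\mathcal{M}$ satisfies the right $\alpha$-condition, then $\mathcal{W}_r(\mathcal{M})$ is an injective right wide Morita context.
   Context: All rings are associative with unity and all modules unitary. A unital Morita context $(T,S,P,Q,\langle,\rangle_T,\langle,\rangle_S)$ consists of rings $T,S$, a $(T,S)$-bimodule $P$, an $(S,T)$-bimodule $Q$, a $(T,T)$-bilinear map $\langle,\rangle_T:P\otimes_SQ\to T$ and an $(S,S)$-bilinear map $\langle,\rangle_S:Q\otimes_TP\to S$, such that $\langle q,p\rangle_Sq'=q\langle p,q'\rangle_T$ and $p\langle q,p'\rangle_S=\langle p,q\rangle_Tp'$ for all $p,p'\in P$, $q,q'\in Q$. It is injective if $\langle,\rangle_T$ and $\langle,\rangle_S$ are injective. $\mathcal{M}$ satisfies the right $\alpha$-condition if (i) for every left $T$-module $U$ the map $Q\otimes_TU\to\mathrm{Hom}_{T}(P,U)$, $q\otimes u\mapsto[p\mapsto\langle p,q\rangle_Tu]$, is injective, and (ii) for every left $S$-module $U$ the map $P\otimes_SU\to\mathrm{Hom}_{S}(Q,U)$, $p\otimes u\mapsto[q\mapsto\langle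 q,p\rangle_Su]$, is injective. A right wide Morita context between Abelian categories $\mathcal{A},\mathcal{B}$ is a datum $(G,\mathcal{A},\mathcal{B},F,\eta,\rho)$ with right exact covariant functors $G:\mathcal{A}\to\mathcal{B}$, $F:\mathcal{B}\to\mathcal{A}$ and natural transformations $\eta:F\circ G\to1_{\mathcal{A}}$, $\rho:G\circ F\to1_{\mathcal{B}}$ such that $G(\eta_A)=\rho_{G(A)}$ and $F(\rho_B)=\eta_{F(B)}$ for all objects $A\in\mathcal{A}$, $B\in\mathcal{B}$. It is injective if $\eta$ and $\rho$ are monomorphisms. The right wide Morita context $\mathcal{W}_r(\mathcal{M})$ induced by $\mathcal{M}$ is given by $G=Q\otimes_T-$, $F=P\otimes_S-$, $\eta_V:P\otimes_S(Q\otimes_TV)\to V$, $p\otimes(q\otimes v)\mapsto\langle p,q\rangle_Tv$, and $\rho_W:Q\otimes_T(P\otimes_SW)\to W$, $q\otimes(p\otimes w)\mapsto\langle q,p\rangle_Sw$. *)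

(* Defs.v *)
From HB Require Import structures.
From mathcomp Require Import all_boot all_algebra.
From mathcomp Require Import boolp freeg.
Import GRing.Theory Quotient.

Set Implicit Arguments.
Unset Strict Implicit.
Unset Printing Implicit Defensive.

Local Open Scope ring_scope.
Local Open Scope quotient_scope.

(* Composition is written in application order: compm g f is g after f. *)
Record preadditive := Preadditive {
  obj :> Type;
  hom : obj -> obj -> zmodType;
  idm : forall X, hom X X;
  compm : forall X Y Z, hom Y Z -> hom X Y -> hom X Z;
  compA : forall X Y Z W (h : hom Z W) (g : hom Y Z) (f : hom X Y),
    compm h (compm g f) = compm (compm h g) f;
  comp1m : forall X Y (f : hom X Y), compm (idm Y) f = f;
  compm1 : forall X Y (f : hom X Y), compm f (idm X) = f;
  compDl : forall X Y Z (g g' : hom Y Z) (f : hom X Y),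
    compm (g + g') f = compm g f + compm g' f;
  compDr : forall X Y Z (g : hom Y Z) (f f' : hom X Y),
    compm g (f + f') = compm g f + compm g f'
}.
Arguments hom {C} X Y : rename.
Arguments idm {C} X : rename.
Arguments compm {C X Y Z} g f : rename.

Section CategoricalNotions.
Variable C : preadditive.
Implicit Types X Y Z W B : C.

Definition monomorphism X Y (f : hom X Y) :=
  forall W (h h' : hom W X), compm f h = compm f h' -> h = h'.

Definition epimorphism X Y (f : hom X Y) :=
  forall W (h h' : hom Y W), compm h f = compm h' f -> h = h'.

Definition is_kernel X Y K (f : hom X Y) (k : hom K X) :=
  compm f k = 0 /\
  forall W (h : hom W X), compm f h = 0 -> exists! h' : hom W K, compm k h' = h.

Definition is_cokernel X Y Q (f : hom X Y) (q : hom Y Q) :=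
  compm q f = 0 /\
  forall W (h : hom Y W), compm h f = 0 -> exists! h' : hom Q W, compm h' q = h.

Definition is_zero_object Z :=
  forall X, (forall f : hom X Z, f = 0) /\ (forall f : hom Z X, f = 0).

(* The equations p1 i2 = 0 and p2 i1 = 0 follow from these. *)
Definition is_biproduct X Y B
    (i1 : hom X B) (i2 : hom Y B) (p1 : hom B X) (p2 : hom B Y) :=
  [/\ compm p1 i1 = idm X, compm p2 i2 = idm Y
    & compm i1 p1 + compm i2 p2 = idm B].

Record is_abelian : Prop := IsAbelian {
  ab_zero : exists Z, is_zero_object Z;
  ab_biproduct : forall X Y, exists B
    (i1 : hom X B) (i2 : hom Y B) (p1 : hom B X) (p2 : hom B Y),
    is_biproduct i1 i2 p1 p2;
  ab_kernel : forall X Y (f : hom X Y),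
    exists K (k : hom K X), is_kernel f k;
  ab_cokernel : forall X Y (f : hom X Y),
    exists Q (q : hom Y Q), is_cokernel f q;
  ab_mono : forall X Y (f : hom X Y), monomorphism f ->
    exists Z (g : hom Y Z), is_kernel g f;
  ab_epi : forall X Y (f : hom X Y), epimorphism f ->
    exists Z (g : hom Z X), is_cokernel g f
}.
End CategoricalNotions.

Record abelianCategory := AbelianCategory {
  abelian_preadditive :> preadditive;
  abelianP : is_abelian abelian_preadditive
}.

Record functor (A B : preadditive) := Functor {
  fobj :> A -> B;
  fmap : forall X Y, hom X Y -> hom (fobj X) (fobj Y);
  fmap_id : forall X, fmap (idm X) = idm (fobj X);
  fmap_comp : forall X Y Z (g : hom Y Z) (f : hom X Y),
    fmap (compm g f) = compm (fmap g) (fmap f)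
}.
Arguments fmap {A B} F {X Y} f : rename.

Definition idF (A : preadditive) : functor A A :=
  @Functor A A id (fun _ _ f => f) (fun _ => erefl) (fun _ _ _ _ _ => erefl).

Section FunctorComposition.
Variables (A B C : preadditive) (G : functor B C) (F : functor A B).

Lemma compF_id X : fmap G (fmap F (idm X)) = idm (G (F X)).
Proof. by rewrite !fmap_id. Qed.

Lemma compF_comp X Y Z (g : hom Y Z) (f : hom X Y) :
  fmap G (fmap F (compm g f)) = compm (fmap G (fmap F g)) (fmap G (fmap F f)).
Proof. by rewrite !fmap_comp. Qed.

Definition compF : functor A C :=
  @Functor A C (fun X => G (F X)) (fun _ _ f => fmap G (fmap F f))
    compF_id compF_comp.
End FunctorComposition.

Record natTrans (A B : preadditive) (F G : functor A B) := NatTrans {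
  component :> forall X : A, hom (F X) (G X);
  naturality : forall X Y (f : hom X Y),
    compm (component Y) (fmap F f) = compm (fmap G f) (component X)
}.

(* X -f-> Y -g-> Z -> 0 is exact iff g is a cokernel of f, so the second
   clause says that right exact sequences are preserved. *)
Definition right_exact (A B : abelianCategory) (F : functor A B) :=
  (forall (X Y : A) (f f' : hom X Y), fmap F (f + f') = fmap F f + fmap F f') /\
  (forall (X Y Z : A) (f : hom X Y) (g : hom Y Z),
     is_cokernel f g -> is_cokernel (fmap F f) (fmap F g)).

Record rightWideMoritaContext (A B : abelianCategory) := RightWideMoritaContext {
  rwG : functor A B;
  rwF : functor B A;
  rwG_exact : right_exact rwG;
  rwF_exact : right_exact rwF;
  rw_eta : natTrans (compF rwF rwG) (idF A);
  rw_rho : natTrans (compF rwG rwF) (idF B);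
  rw_etaP : forall X : A, fmap rwG (rw_eta X) = rw_rho (rwG X);
  rw_rhoP : forall Y : B, fmap rwF (rw_rho Y) = rw_eta (rwF Y)
}.

(* A natural transformation is a monomorphism when its components are. *)
Definition injective_rightWideMoritaContext (A B : abelianCategory)
    (W : rightWideMoritaContext A B) :=
  (forall X : A, monomorphism (rw_eta W X)) /\ (forall Y : B, monomorphism (rw_rho W Y)).

Section LinearZmodule.
Variables (R : pzRingType) (U V : lmodType R).

Lemma linear_ext (f g : {linear U -> V}) : f =1 g -> f = g.
Proof.
case: f g => [f [[f1] [f2]]] [g [[g1] [g2]]] /= /funext efg.
by case: _ / efg g1 g2 => g1 g2; congr GRing.Linear.Pack;
   congr GRing.Linear.Class; [congr Algebra.isNmodMorphism.Axioms_
  | congr GRing.isScalable.Axioms_]; exact: Prop_irrelevance.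
Qed.

Definition linear_of (f : U -> V) (lf : linear f) : {linear U -> V} :=
  HB.pack f (GRing.isLinear.Build R U V *:%R f lf).

HB.instance Definition _ := gen_eqMixin {linear U -> V}.
HB.instance Definition _ := gen_choiceMixin {linear U -> V}.

Definition lin_zero : {linear U -> V} := \0.
Definition lin_opp (f : {linear U -> V}) : {linear U -> V} := \- f.
Definition lin_add (f g : {linear U -> V}) : {linear U -> V} := f \+ g.

Lemma lin_addA : associative lin_add.
Proof. by move=> f g h; apply: linear_ext => x /=; rewrite addrA. Qed.

Lemma lin_addC : commutative lin_add.
Proof. by move=> f g; apply: linear_ext => x /=; rewrite addrC. Qed.

Lemma lin_add0 : left_id lin_zero lin_add.
Proof. by move=> f; apply: linear_ext => x /=; rewrite add0r. Qed.

Lemma lin_addN : left_inverse lin_zero lin_opp lin_add.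
Proof. by move=> f; apply: linear_ext => x /=; rewrite addNr. Qed.

HB.instance Definition _ := GRing.isZmodule.Build {linear U -> V}
  lin_addA lin_addC lin_add0 lin_addN.
End LinearZmodule.

Section ModulePreadditive.
Variable R : pzRingType.

Definition lin_id (X : lmodType R) : {linear X -> X} := idfun.
Definition lin_comp (X Y Z : lmodType R)
  (g : {linear Y -> Z}) (f : {linear X -> Y}) : {linear X -> Z} := g \o f.

Lemma lin_compDr (X Y Z : lmodType R)
  (g : {linear Y -> Z}) (f f' : {linear X -> Y}) :
  lin_comp g (f + f') = lin_comp g f + lin_comp g f'.
Proof. by apply: linear_ext => x; apply: linearD. Qed.

Lemma lin_compA (X Y Z W : lmodType R) (h : {linear Z -> W})
  (g : {linear Y -> Z}) (f : {linear X -> Y}) :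
  lin_comp h (lin_comp g f) = lin_comp (lin_comp h g) f.
Proof. exact: linear_ext. Qed.

Lemma lin_comp1 (X Y : lmodType R) (f : {linear X -> Y}) :
  lin_comp (lin_id Y) f = f.
Proof. exact: linear_ext. Qed.

Lemma lin_compm1 (X Y : lmodType R) (f : {linear X -> Y}) :
  lin_comp f (lin_id X) = f.
Proof. exact: linear_ext. Qed.

Lemma lin_compDl (X Y Z : lmodType R)
  (g g' : {linear Y -> Z}) (f : {linear X -> Y}) :
  lin_comp (g + g') f = lin_comp g f + lin_comp g' f.
Proof. exact: linear_ext. Qed.

Definition lmod_preadditive : preadditive :=
  @Preadditive (lmodType R) (fun X Y => {linear X -> Y}) lin_id lin_comp
    lin_compA lin_comp1 lin_compm1 lin_compDl lin_compDr.
End ModulePreadditive.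

Section KernelModule.
Variables (R : pzRingType) (X Y : lmodType R) (f : {linear X -> Y}).

Definition ker_pred : {pred X} := [pred x | f x == 0].

Lemma ker_pred_closed : submod_closed ker_pred.
Proof.
split=> [|a x y]; rewrite !inE ?linear0 // => /eqP fx /eqP fy.
by rewrite linearP fx fy scaler0 addr0.
Qed.

HB.instance Definition _ := GRing.isSubmodClosed.Build R X ker_pred ker_pred_closed.

Record ker_module := KerModule { ker_val : X; ker_valP : ker_val \in ker_pred }.
HB.instance Definition _ := [isSub for ker_val].
HB.instance Definition _ := [Choice of ker_module by <:].
HB.instance Definition _ := [SubChoice_isSubLmodule of ker_module by <:].
End KernelModule.

Section QuotientModule.
Variables (R : pzRingType) (X Y : lmodType R) (f : {linear X -> Y}).

Definition im_pred : {pred Y} := [pred y | `[< exists x, f x = y >]].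

Lemma im_predP y : reflect (exists x, f x = y) (y \in im_pred).
Proof. exact: asboolP. Qed.

Lemma im_pred_closed : submod_closed im_pred.
Proof.
split=> [|a x y]; first by apply/im_predP; exists 0; rewrite linear0.
move=> /im_predP[u <-] /im_predP[v <-]; apply/im_predP.
by exists (a *: u + v); rewrite linearP.
Qed.

HB.instance Definition _ := GRing.isSubmodClosed.Build R Y im_pred im_pred_closed.

Definition coker_module := quot im_pred.
HB.instance Definition _ := GRing.Zmodule.on coker_module.

Definition coker_pi (y : Y) : coker_module := \pi_(quot im_pred) y.

Lemma coker_piK (x : coker_module) : coker_pi (repr x) = x.
Proof. exact: reprK. Qed.

Lemma coker_piD : {morph coker_pi : x y / x + y}.
Proof. by move=> x y; rewrite /coker_pi piE. Qed.

Lemma coker_pi_eq x y : coker_pi x = coker_pi y <-> x - y \in im_pred.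
Proof. by rewrite idealrBE; split=> /eqP. Qed.

Definition coker_scale (a : R) (x : coker_module) : coker_module :=
  coker_pi (a *: repr x).

Lemma coker_scaleE a y : coker_scale a (coker_pi y) = coker_pi (a *: y).
Proof.
apply/coker_pi_eq; rewrite -scalerBr rpredZ//.
by apply/coker_pi_eq; rewrite coker_piK.
Qed.

Lemma coker_scaleA a b x :
  coker_scale a (coker_scale b x) = coker_scale (a * b) x.
Proof. by rewrite -[x]coker_piK !coker_scaleE scalerA. Qed.

Lemma coker_scale1 : left_id 1 coker_scale.
Proof. by move=> x; rewrite -[x]coker_piK !coker_scaleE scale1r. Qed.

Lemma coker_scaleDr : right_distributive coker_scale +%R.
Proof.
move=> a x y; rewrite -[x]coker_piK -[y]coker_piK -coker_piD !coker_scaleE.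
by rewrite scalerDr coker_piD.
Qed.

Lemma coker_scaleDl x : {morph coker_scale^~ x : a b / a + b}.
Proof.
by move=> a b /=; rewrite -[x]coker_piK !coker_scaleE scalerDl coker_piD.
Qed.

HB.instance Definition _ := GRing.Zmodule_isLmodule.Build R coker_module
  coker_scaleA coker_scale1 coker_scaleDr coker_scaleDl.

Lemma coker_pi_linear : linear coker_pi.
Proof. by move=> a x y; rewrite coker_piD -coker_scaleE. Qed.

HB.instance Definition _ :=
  GRing.isLinear.Build R Y coker_module *:%R coker_pi coker_pi_linear.

Definition coker_lin : {linear Y -> coker_module} := coker_pi.

Lemma coker_pi_eq0 y : coker_pi y = 0 <-> exists x, f x = y.
Proof.
rewrite -(linear0 coker_pi) coker_pi_eq subr0.
by split=> /im_predP.
Qed.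
End QuotientModule.

Section ModuleAbelian.
Variable R : pzRingType.
Local Notation Mod := (lmod_preadditive R).

Lemma lmod_zero : exists Z : Mod, is_zero_object Z.
Proof.
exists ('rV[R]_0 : lmodType R) => X; split=> f; apply: linear_ext => x.
  by apply/rowP; case.
by rewrite (_ : x = 0) ?linear0//; apply/rowP; case.
Qed.

Lemma lmod_biproduct (X Y : Mod) : exists B
    (i1 : hom X B) (i2 : hom Y B) (p1 : hom B X) (p2 : hom B Y),
  is_biproduct i1 i2 p1 p2.
Proof.
pose B : lmodType R := (X * Y)%type.
have h1 : linear (fun x : X => (x, 0) : B).
  by move=> a x y; congr pair => /=; rewrite ?scaler0 ?addr0.
have h2 : linear (fun y : Y => (0, y) : B).
  by move=> a x y; congr pair => /=; rewrite ?scaler0 ?addr0.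
have h3 : linear (fst : B -> X) by [].
have h4 : linear (snd : B -> Y) by [].
exists B, (linear_of h1), (linear_of h2), (linear_of h3), (linear_of h4); split; apply: linear_ext => //.
by move=> [x y]; congr pair => /=; rewrite ?addr0 ?add0r.
Qed.

Lemma lmod_kernel (X Y : Mod) (f : hom X Y) :
  exists K (k : hom K X), is_kernel f k.
Proof.
exists (ker_module f : lmodType R), (val : {linear ker_module f -> X}).
split=> [|W h fh]; first by apply: linear_ext => x; apply/eqP/(valP x).
have hK x : h x \in ker_pred f.
  by have := congr1 (fun g : {linear _ -> _} => g x) fh; rewrite inE => /= ->.
have lK : linear (fun x => KerModule (hK x)).
  by move=> a x y; apply: val_inj; rewrite /= linearP.
exists (linear_of lK); split; first exact: linear_ext.
move=> g gh; apply: linear_ext => x; apply: val_inj => /=.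
by rewrite -gh.
Qed.

Lemma lin_eq (X Y : lmodType R) (f g : {linear X -> Y}) x : f = g -> f x = g x.
Proof. by move->. Qed.

Lemma lin_choice (X Y Z : lmodType R) (f : {linear X -> Z})
    (g : {linear Y -> Z}) :
  injective g -> (forall x, exists y, g y = f x) ->
  exists h : {linear X -> Y}, lin_comp g h = f.
Proof.
move=> gI /choice[h hE].
have lh : linear h by move=> a x y; apply: gI; rewrite linearP !hE linearP.
by exists (linear_of lh); apply: linear_ext => x; apply: hE.
Qed.

(* A linear surjection is a cokernel of any map whose image is its kernel. *)
Lemma surj_cokernel (X Y Z : Mod) (f : hom X Y) (g : hom Y Z) :
  compm g f = 0 -> (forall z, exists y, (g : {linear Y -> Z}) y = z) ->
  (forall y, (g : {linear Y -> Z}) y = 0 ->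
     exists x, (f : {linear X -> Y}) x = y) ->
  is_cokernel f g.
Proof.
move=> gf gS gK; split=> // W h hf.
have [s sE] := choice gS.
have hs y y' : (g : {linear _ -> _}) y = (g : {linear _ -> _}) y' ->
    (h : {linear _ -> _}) y = (h : {linear _ -> _}) y'.
  move=> e; apply/eqP; rewrite -subr_eq0 -linearB; apply/eqP.
  have [|x <-] := gK (y - y'); first by rewrite linearB e subrr.
  exact: (lin_eq x hf).
have lh : linear (fun z => (h : {linear Y -> W}) (s z)).
  move=> a z z'; rewrite -linearP; apply: hs.
  by rewrite sE linearP !sE.
exists (linear_of lh); split.
  by apply: linear_ext => y; apply: hs; rewrite sE.
move=> k kg; apply: linear_ext => z /=.
by rewrite -kg /= sE.
Qed.

Lemma lmod_cokernel_pi (X Y : Mod) (f : hom X Y) :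
  @is_cokernel Mod X Y (coker_module f : lmodType R) f (coker_lin f).
Proof.
apply: surj_cokernel.
- by apply: linear_ext => x; apply/coker_pi_eq0; exists x.
- by move=> z; exists (repr z); apply: coker_piK.
- by move=> y /coker_pi_eq0.
Qed.

Lemma lmod_monic (X Y : Mod) (f : hom X Y) :
  monomorphism f -> injective (f : {linear X -> Y}).
Proof.
move=> fM x y fxy; apply/eqP; rewrite -subr_eq0; apply/eqP.
have k : x - y \in ker_pred f by rewrite inE linearB fxy subrr.
pose v : {linear ker_module f -> X} := val.
have v0 : v = 0.
  apply: (fM (ker_module f : lmodType R)); apply: linear_ext => -[z zk] /=.
  by rewrite linear0; apply/eqP.
exact: (lin_eq (KerModule k) v0).
Qed.

Lemma lmod_epic (X Y : Mod) (f : hom X Y) :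
  epimorphism f -> forall y, exists x, (f : {linear X -> Y}) x = y.
Proof.
move=> fE y; apply/coker_pi_eq0.
suff e : coker_lin f = 0 by apply: (lin_eq y e).
apply: (fE (coker_module f : lmodType R)).
by rewrite (proj1 (lmod_cokernel_pi f)); apply: linear_ext.
Qed.

Lemma lmod_mono (X Y : Mod) (f : hom X Y) :
  monomorphism f -> exists Z (g : hom Y Z), is_kernel g f.
Proof.
move=> /lmod_monic fI; have [pf pU] := lmod_cokernel_pi f.
exists (coker_module f : lmodType R), (coker_lin f); split=> // W h ph.
have [x|k kE] := lin_choice (f := h) fI.
  by apply/coker_pi_eq0; apply: (lin_eq x ph).
exists k; split=> // k' k'E; apply: linear_ext => x; apply: fI.
by rewrite -[LHS]/(lin_comp f k x) kE -k'E.
Qed.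

Lemma lmod_epi (X Y : Mod) (f : hom X Y) :
  epimorphism f -> exists Z (g : hom Z X), is_cokernel g f.
Proof.
move=> /lmod_epic fS.
exists (ker_module f : lmodType R), (val : {linear ker_module f -> X}).
apply: surj_cokernel => //.
  by apply: linear_ext => x; apply/eqP/(valP x).
by move=> x /eqP fx; exists (KerModule (f := f) fx).
Qed.

Definition lmod_abelianP : is_abelian Mod := IsAbelian
  lmod_zero lmod_biproduct lmod_kernel
  (fun X Y f => ex_intro _ _ (ex_intro _ _ (lmod_cokernel_pi f)))
  lmod_mono lmod_epi.

Definition lmod_category : abelianCategory := AbelianCategory lmod_abelianP.
End ModuleAbelian.

(* An (R, S)-bimodule: a left R-module with a compatible right S-action, as
   rings need not be commutative (pzRingType also allows the zero ring). *)
HB.mixin Record Lmodule_isBimodule (R S : pzRingType) M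
    of GRing.Lmodule R M := {
  ract : M -> S -> M;
  ractDl : forall s, {morph ract^~ s : x y / x + y};
  ractDr : forall x, {morph ract x : s s' / s + s'};
  ract1 : forall x, ract x 1 = x;
  ractM : forall x s s', ract x (s * s') = ract (ract x s) s';
  scale_ract : forall a x s, a *: ract x s = ract (a *: x) s
}.

#[short(type="bimodType")]
HB.structure Definition Bimodule (R S : pzRingType) :=
  {M of GRing.Lmodule R M & Lmodule_isBimodule R S M}.

Reserved Notation "x *> s" (at level 40, left associativity).
Notation "x *> s" := (ract x s) : ring_scope.

Section RegularBimodule.
Variable R : pzRingType.

Lemma regular_ractDl (s : R) : {morph (fun x : R^o => x * s) : x y / x + y}.
Proof. by move=> x y /=; rewrite mulrDl. Qed.

HB.instance Definition _ := Lmodule_isBimodule.Build R R R^o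
  regular_ractDl (@mulrDr R) (@mulr1 R) (@mulrA R) (@mulrA R).
End RegularBimodule.

Record bimodHom (R S : pzRingType) (M N : bimodType R S) := BimodHom {
  bimodHom_linear :> {linear M -> N};
  bimodHom_ract : forall x s, bimodHom_linear (x *> s) = bimodHom_linear x *> s
}.

(* P (x)_S U for an (R, S)-bimodule P and a left S-module U: the free abelian
   group on P * U modulo the usual relations, as a left R-module. *)
Section TensorProduct.
Variables (R S : pzRingType) (P : bimodType R S) (U : lmodType S).

Definition fgen (p : P) (u : U) : {freeg (P * U)} := << (p, u) >>.

(* The subgroup of the free abelian group on P * U that is factored out. *)
Inductive tensor_rel : {freeg (P * U)} -> Prop :=
| tensor_rel_Dl p p' u : tensor_rel (fgen (p + p') u - (fgen p u + fgen p' u))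
| tensor_rel_Dr p u u' : tensor_rel (fgen p (u + u') - (fgen p u + fgen p u'))
| tensor_rel_M p s u : tensor_rel (fgen (p *> s) u - fgen p (s *: u))
| tensor_rel_0 : tensor_rel 0
| tensor_rel_B x y : tensor_rel x -> tensor_rel y -> tensor_rel (x - y).

Definition tensor_pred : {pred {freeg (P * U)}} := [pred x | `[< tensor_rel x >]].

Lemma tensor_predP x : reflect (tensor_rel x) (x \in tensor_pred).
Proof. exact: asboolP. Qed.

Lemma tensor_pred_closed : zmod_closed tensor_pred.
Proof.
split; first exact/tensor_predP/tensor_rel_0.
by move=> x y /tensor_predP hx /tensor_predP hy; apply/tensor_predP/tensor_rel_B.
Qed.

HB.instance Definition _ :=
  GRing.isZmodClosed.Build {freeg (P * U)} tensor_pred tensor_pred_closed.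

Definition tensor := quot tensor_pred.
HB.instance Definition _ := GRing.Zmodule.on tensor.

Definition tensor_pi (x : {freeg (P * U)}) : tensor := \pi_(quot tensor_pred) x.

Definition tens (p : P) (u : U) : tensor := tensor_pi (fgen p u).

Lemma tensor_piK (x : tensor) : tensor_pi (repr x) = x.
Proof. exact: reprK. Qed.

Lemma tensor_piB : {morph tensor_pi : x y / x - y}.
Proof. by move=> x y; rewrite /tensor_pi piE. Qed.

Lemma tensor_piD : {morph tensor_pi : x y / x + y}.
Proof. by move=> x y; rewrite /tensor_pi piE. Qed.

Lemma tensor_pi0 : tensor_pi 0 = 0.
Proof. by rewrite -[0 in LHS](subrr 0) tensor_piB subrr. Qed.

Lemma tensor_pi_eq x y : tensor_pi x = tensor_pi y <-> tensor_rel (x - y).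
Proof.
split=> [/eqP|/tensor_predP]; first by rewrite -idealrBE => /tensor_predP.
by rewrite idealrBE => /eqP.
Qed.

Lemma tensDl p p' u : tens (p + p') u = tens p u + tens p' u.
Proof. by rewrite -tensor_piD; apply/tensor_pi_eq/tensor_rel_Dl. Qed.

Lemma tensDr p u u' : tens p (u + u') = tens p u + tens p u'.
Proof. by rewrite -tensor_piD; apply/tensor_pi_eq/tensor_rel_Dr. Qed.

Lemma tens0 p : tens p 0 = 0.
Proof. by apply: (addrI (tens p 0)); rewrite -tensDr !addr0. Qed.

Lemma tensB p u u' : tens p (u - u') = tens p u - tens p u'.
Proof. by apply/eqP; rewrite -subr_eq opprK -tensDr subrK. Qed.

Lemma tensM p s u : tens (p *> s) u = tens p (s *: u).
Proof. exact/tensor_pi_eq/tensor_rel_M. Qed.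

Lemma tensor_ind (K : tensor -> Prop) :
  (forall p u, K (tens p u)) -> K 0 -> (forall x y, K x -> K y -> K (x - y)) ->
  forall x, K x.
Proof.
move=> Kt K0 KB x.
have KN y : K y -> K (- y) by move=> ?; rewrite -sub0r; apply: KB.
have KD y z : K y -> K z -> K (y + z).
  by move=> ? /KN ?; rewrite -[z]opprK; apply: KB.
rewrite -[x]tensor_piK -[repr x]freeg_sumE.
elim: (dom _) => [|[p u] s IH]; first by rewrite big_nil tensor_pi0.
rewrite big_cons tensor_piD; apply: (KD _ _ _ IH).
have KZ n : K (tensor_pi << n%:Z *g (p, u) >>).
  elim: n => [|n IHn]; first by rewrite freegU0 tensor_pi0.
  by rewrite -addn1 PoszD -freegUD tensor_piD; apply: (KD _ _ IHn); apply: Kt.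
case: (coeff _ _) => n; first exact: KZ.
by rewrite NegzE -freegUN -sub0r tensor_piB tensor_pi0; apply: (KB _ _ K0).
Qed.

Section Lift.
Variables (M : zmodType) (f : P -> U -> M).

Definition balanced :=
  [/\ forall p p' u, f (p + p') u = f p u + f p' u,
      forall p u u', f p (u + u') = f p u + f p u'
    & forall p s u, f (p *> s) u = f p (s *: u)].

(* The additive map sending tens p u to f p u, for a balanced f. *)
Definition tensor_lift (x : tensor) : M :=
  fglift (fun pu => f pu.1 pu.2 : zmodule M) (repr x).

Hypothesis fB : balanced.

Let flift x : M := fglift (fun pu => f pu.1 pu.2 : zmodule M) x.

Lemma fliftB : {morph flift : x y / x - y}.
Proof.
exact: (@lift_is_additive int (P * U)%type (zmodule M)
  (fun pu => f pu.1 pu.2)).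
Qed.

Lemma flift_fgen p u : flift (fgen p u) = f p u.
Proof. by rewrite /flift liftU scale1r. Qed.

Lemma flift0 : flift 0 = 0.
Proof. by rewrite -[0 in LHS](subrr 0) fliftB subrr. Qed.

Lemma fliftD : {morph flift : x y / x + y}.
Proof.
by move=> x y; rewrite -[y in LHS]opprK -[- y]sub0r !fliftB flift0 sub0r opprK.
Qed.

Lemma flift_rel x : tensor_rel x -> flift x = 0.
Proof.
have [fl fr fm] := fB.
elim=> {x} [p p' u|p u u'|p s u||x y _ hx _ hy].
- by rewrite fliftB fliftD !flift_fgen fl subrr.
- by rewrite fliftB fliftD !flift_fgen fr subrr.
- by rewrite fliftB !flift_fgen fm subrr.
- exact: flift0.
- by rewrite fliftB hx hy subrr.
Qed.

Lemma tensor_lift_pi x : tensor_lift (tensor_pi x) = flift x.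
Proof.
rewrite -[LHS]/(flift (repr (tensor_pi x))); apply/eqP; rewrite -subr_eq0 -fliftB; apply/eqP.
by apply/flift_rel/tensor_pi_eq; rewrite tensor_piK.
Qed.

Lemma tensor_lift_tens p u : tensor_lift (tens p u) = f p u.
Proof. by rewrite tensor_lift_pi flift_fgen. Qed.

Lemma tensor_liftB : {morph tensor_lift : x y / x - y}.
Proof.
move=> x y; rewrite -[x]tensor_piK -[y]tensor_piK -tensor_piB.
by rewrite !tensor_lift_pi fliftB.
Qed.

Definition tensor_additive : {additive tensor -> M} :=
  HB.pack tensor_lift (GRing.isZmodMorphism.Build tensor M tensor_lift tensor_liftB).

Lemma tensor_additive_tens p u : tensor_additive (tens p u) = f p u.
Proof. exact: tensor_lift_tens. Qed.
End Lift.

Lemma tensor_ext (M : zmodType) (f g : {additive tensor -> M}) :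
  (forall p u, f (tens p u) = g (tens p u)) -> f =1 g.
Proof.
move=> fg; elim/tensor_ind => // [|x y fx fy]; first by rewrite !raddf0.
by rewrite !raddfB fx fy.
Qed.

Definition tensor_scale (a : R) : tensor -> tensor :=
  tensor_lift (fun p u => tens (a *: p) u).

Lemma tensor_scale_balanced a : balanced (fun p u => tens (a *: p) u).
Proof.
split=> [p p' u|p u u'|p s u]; first by rewrite scalerDr tensDl.
  by rewrite tensDr.
by rewrite scale_ract tensM.
Qed.

Lemma tensor_scale_tens a p u : tensor_scale a (tens p u) = tens (a *: p) u.
Proof. exact/tensor_lift_tens/tensor_scale_balanced. Qed.

Lemma tensor_scaleB a : {morph tensor_scale a : x y / x - y}.
Proof. exact/tensor_liftB/tensor_scale_balanced. Qed.

Lemma tensor_scale0 a : tensor_scale a 0 = 0.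
Proof. by rewrite -[0 in LHS](subrr 0) tensor_scaleB subrr. Qed.

Lemma tensor_scaleA a b x : tensor_scale a (tensor_scale b x) = tensor_scale (a * b) x.
Proof.
elim/tensor_ind: x => [p u||x y hx hy]; rewrite ?tensor_scale0//.
  by rewrite !tensor_scale_tens scalerA.
by rewrite !tensor_scaleB hx hy.
Qed.

Lemma tensor_scale1 : left_id 1 tensor_scale.
Proof.
elim/tensor_ind => [p u||x y hx hy]; rewrite ?tensor_scale0//.
  by rewrite tensor_scale_tens scale1r.
by rewrite tensor_scaleB hx hy.
Qed.

Lemma tensor_scaleDr : right_distributive tensor_scale +%R.
Proof.
move=> a x y; rewrite -[y in LHS]opprK -[- y]sub0r.
by rewrite !tensor_scaleB tensor_scale0 sub0r opprK.
Qed.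

Lemma tensor_scaleDl x : {morph tensor_scale^~ x : a b / a + b}.
Proof.
move=> a b /=; elim/tensor_ind: x => [p u||x y hx hy].
- by rewrite !tensor_scale_tens scalerDl tensDl.
- by rewrite !tensor_scale0 addr0.
- by rewrite !tensor_scaleB hx hy opprD addrACA.
Qed.

HB.instance Definition _ := GRing.Zmodule_isLmodule.Build R tensor
  tensor_scaleA tensor_scale1 tensor_scaleDr tensor_scaleDl.

Lemma scale_tens a p u : a *: tens p u = tens (a *: p) u.
Proof. exact: tensor_scale_tens. Qed.

Section LinearLift.
Variables (M : lmodType R) (f : P -> U -> M).
Hypotheses (fB : balanced f) (fZ : forall a p u, f (a *: p) u = a *: f p u).

Lemma tensor_lift_linear : linear (tensor_lift f).
Proof.
have f0 : tensor_lift f 0 = 0.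
  by rewrite -[0 in LHS](subrr 0) tensor_liftB// subrr.
move=> a x y; rewrite -[y in LHS]opprK tensor_liftB// -[- y]sub0r.
rewrite tensor_liftB// f0 sub0r opprK; congr +%R.
elim/tensor_ind: x => [p u||x z hx hz].
- by rewrite scale_tens !tensor_lift_tens.
- by rewrite scaler0 f0 scaler0.
- by rewrite scalerBr !tensor_liftB// scalerBr hx hz.
Qed.

Definition tensor_linear : {linear tensor -> M} := linear_of tensor_lift_linear.

Lemma tensor_linear_tens p u : tensor_linear (tens p u) = f p u.
Proof. exact: tensor_lift_tens. Qed.
End LinearLift.

Lemma tensor_linear_ext (M : lmodType R) (f g : {linear tensor -> M}) :
  (forall p u, f (tens p u) = g (tens p u)) -> f = g.
Proof. by move=> fg; apply: linear_ext; apply: tensor_ext. Qed.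
End TensorProduct.

Section TensorBimodule.
Variables (R S S' : pzRingType) (P : bimodType R S) (Q : bimodType S S').
Local Notation PQ := (tensor P Q).

Definition tensor_ract (x : PQ) (t : S') : PQ :=
  tensor_lift (fun p q => tens p (q *> t)) x.

Lemma tensor_ract_balanced t :
  balanced (fun (p : P) (q : Q) => tens p (q *> t)).
Proof.
split=> [p p' u|p u u'|p s u]; first by rewrite tensDl.
  by rewrite ractDl tensDr.
by rewrite -scale_ract tensM.
Qed.

Lemma tensor_ract_tens t p q : tensor_ract (tens p q) t = tens p (q *> t).
Proof. exact: (tensor_lift_tens (tensor_ract_balanced t)). Qed.

Lemma tensor_ractB t : {morph tensor_ract^~ t : x y / x - y}.
Proof. exact: (tensor_liftB (tensor_ract_balanced t)). Qed.

Lemma tensor_ract0 t : tensor_ract 0 t = 0.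
Proof. by rewrite -[0 in LHS](subrr 0) tensor_ractB subrr. Qed.

Lemma tensor_ractDl t : {morph tensor_ract^~ t : x y / x + y}.
Proof.
move=> x y /=; rewrite -[y in LHS]opprK -[- y]sub0r.
by rewrite !tensor_ractB tensor_ract0 sub0r opprK.
Qed.

Lemma tensor_ractDr x : {morph tensor_ract x : t t' / t + t'}.
Proof.
move=> t t'; elim/tensor_ind: x => [p u||x y hx hy].
- by rewrite !tensor_ract_tens ractDr tensDr.
- by rewrite !tensor_ract0 addr0.
- by rewrite !tensor_ractB hx hy opprD addrACA.
Qed.

Lemma tensor_ract1 x : tensor_ract x 1 = x.
Proof.
elim/tensor_ind: x => [p u||x y hx hy]; rewrite ?tensor_ract0//.
  by rewrite tensor_ract_tens ract1.
by rewrite tensor_ractB hx hy.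
Qed.

Lemma tensor_ractM x t t' :
  tensor_ract x (t * t') = tensor_ract (tensor_ract x t) t'.
Proof.
elim/tensor_ind: x => [p u||x y hx hy]; rewrite ?tensor_ract0//.
  by rewrite !tensor_ract_tens ractM.
by rewrite !tensor_ractB hx hy.
Qed.

Lemma scale_tensor_ract a x t : a *: tensor_ract x t = tensor_ract (a *: x) t.
Proof.
elim/tensor_ind: x => [p u||x y hx hy].
- by rewrite scale_tens !tensor_ract_tens scale_tens.
- by rewrite tensor_ract0 !scaler0 tensor_ract0.
- by rewrite scalerBr !tensor_ractB scalerBr hx hy.
Qed.

HB.instance Definition _ := Lmodule_isBimodule.Build R S' PQ
  tensor_ractDl tensor_ractDr tensor_ract1 tensor_ractM scale_tensor_ract.

Lemma tens_ract p q t : (tens p q : PQ) *> t = tens p (q *> t).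
Proof. exact: tensor_ract_tens. Qed.
End TensorBimodule.

Section TensorFunctor.
Variables (R S : pzRingType) (P : bimodType R S).

Section Map.
Variables (U V : lmodType S) (f : {linear U -> V}).

Lemma tensor_map_balanced : balanced (fun (p : P) u => tens p (f u)).
Proof.
split=> [p p' u|p u u'|p s u]; first by rewrite tensDl.
  by rewrite linearD tensDr.
by rewrite linearZ tensM.
Qed.

Lemma tensor_map_scale a (p : P) u : tens (a *: p) (f u) = a *: tens p (f u).
Proof. by rewrite scale_tens. Qed.

Definition tensor_map : {linear tensor P U -> tensor P V} :=
  tensor_linear tensor_map_balanced tensor_map_scale.

Lemma tensor_map_tens p u : tensor_map (tens p u) = tens p (f u).
Proof. exact: tensor_linear_tens. Qed.
End Map.

Lemma tensor_map_id (U : lmodType S) :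
  tensor_map (lin_id U) = lin_id (tensor P U).
Proof. by apply: tensor_linear_ext => p u; rewrite tensor_map_tens. Qed.

Lemma tensor_map_comp (U V W : lmodType S)
    (g : {linear V -> W}) (f : {linear U -> V}) :
  tensor_map (lin_comp g f) = lin_comp (tensor_map g) (tensor_map f).
Proof.
apply: tensor_linear_ext => p u; rewrite tensor_map_tens.
rewrite -[RHS]/(tensor_map g (tensor_map f (tens p u))).
by rewrite !tensor_map_tens.
Qed.

Definition tensor_functor : functor (lmod_category S) (lmod_category R) :=
  @Functor (lmod_category S) (lmod_category R)
    (fun U => tensor P U) tensor_map tensor_map_id tensor_map_comp.

(* Hom_R(P, W) as a left S-module, for the adjunction with the tensor product. *)
Section HomModule.
Variable W : lmodType R.

Definition hom_module := {linear P -> W}.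
HB.instance Definition _ := GRing.Zmodule.on hom_module.

Lemma hom_scale_linear (s : S) (f : {linear P -> W}) : linear (fun p => f (p *> s)).
Proof. by move=> a x y; rewrite ractDl -scale_ract linearP. Qed.

Definition hom_scale (s : S) (f : hom_module) : hom_module :=
  linear_of (hom_scale_linear s f).

Lemma hom_scaleA s t f : hom_scale s (hom_scale t f) = hom_scale (s * t) f.
Proof. by apply: linear_ext => p /=; rewrite ractM. Qed.

Lemma hom_scale1 : left_id 1 hom_scale.
Proof. by move=> f; apply: linear_ext => p /=; rewrite ract1. Qed.

Lemma hom_scaleDr : right_distributive hom_scale +%R.
Proof. by move=> s f g; apply: linear_ext => p. Qed.

Lemma hom_scaleDl f : {morph hom_scale^~ f : s t / s + t}.
Proof. by move=> s t; apply: linear_ext => p /=; rewrite ractDr linearD. Qed.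

HB.instance Definition _ := GRing.Zmodule_isLmodule.Build S hom_module
  hom_scaleA hom_scale1 hom_scaleDr hom_scaleDl.

Section Curry.
Variables (U : lmodType S) (h : {linear tensor P U -> W}).

Lemma curry_app_linear u : linear (fun p => h (tens p u)).
Proof. by move=> a x y; rewrite tensDl -scale_tens linearP. Qed.

Lemma curry_linear :
  linear (fun u => linear_of (curry_app_linear u) : hom_module).
Proof.
by move=> s x y; apply: linear_ext => p /=; rewrite tensDr linearD tensM.
Qed.

Definition curry : {linear U -> hom_module} := linear_of curry_linear.
End Curry.

Section Uncurry.
Variables (U : lmodType S) (k : {linear U -> hom_module}).

Lemma uncurry_balanced : balanced (fun (p : P) u => (k u : {linear P -> W}) p).
Proof.
split=> [p p' u|p u u'|p s u]; first by rewrite linearD.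
  by rewrite linearD.
by rewrite linearZ.
Qed.

Lemma uncurry_scale a (p : P) u :
  (k u : {linear P -> W}) (a *: p) = a *: (k u : {linear P -> W}) p.
Proof. by rewrite linearZ. Qed.

Definition uncurry : {linear tensor P U -> W} :=
  tensor_linear uncurry_balanced uncurry_scale.

Lemma uncurry_tens p u : uncurry (tens p u) = (k u : {linear P -> W}) p.
Proof. exact: tensor_linear_tens. Qed.
End Uncurry.
End HomModule.

Lemma tensor_right_exact : right_exact tensor_functor.
Proof.
split=> [X Y f f'|X Y Z f g [gf gU]].
  apply: tensor_linear_ext => p u.
  rewrite -[RHS]/(tensor_map f (tens p u) + tensor_map f' (tens p u)).
  rewrite -[LHS]/(tensor_map (f + f') (tens p u)) !tensor_map_tens.
  exact: tensDr.
split=> [|W h hf].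
  rewrite -fmap_comp gf; apply: tensor_linear_ext => p u.
  rewrite -[LHS]/(tensor_map 0 (tens p u)) tensor_map_tens; exact: tens0.
have [|k [kg kU]] := gU (hom_module W : lmodType S) (curry h).
  apply: linear_ext => u; apply: linear_ext => p.
  rewrite -[RHS]/((0 : {linear tensor P X -> W}) (tens p u)) -(lin_eq (tens p u) hf).
  by rewrite -[RHS]/(h (tensor_map f (tens p u))) tensor_map_tens.
exists (uncurry k); split.
  apply: tensor_linear_ext => p u.
  rewrite -[LHS]/(uncurry k (tensor_map g (tens p u))).
  rewrite tensor_map_tens uncurry_tens.
  exact: (lin_eq p (lin_eq u kg)).
move=> k' k'g; apply: tensor_linear_ext => p u; rewrite uncurry_tens.
rewrite (kU (curry k')) //; apply: linear_ext => v; apply: linear_ext => q.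
rewrite -[RHS]/(h (tens q v)) -k'g.
by rewrite -[RHS]/(k' (tensor_map g (tens q v))) tensor_map_tens.
Qed.
End TensorFunctor.

Record moritaContext (T S : pzRingType) := MoritaContext {
  mP : bimodType T S;
  mQ : bimodType S T;
  pairT : bimodHom (tensor mP mQ : bimodType T T) (T^o : bimodType T T);
  pairS : bimodHom (tensor mQ mP : bimodType S S) (S^o : bimodType S S);
  pairSP : forall (q : mQ) (p : mP) (q' : mQ),
    (pairS (tens q p) : S) *: q' = q *> (pairT (tens p q') : T);
  pairTP : forall (p : mP) (q : mQ) (p' : mP),
    p *> (pairS (tens q p') : S) = (pairT (tens p q) : T) *: p'
}.

Definition injective_moritaContext (T S : pzRingType) (M : moritaContext T S) :=
  injective (pairT M) /\ injective (pairS M).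

(* Stated for one pairing h = <,>_T; the maps for <,>_S are obtained by
   exchanging the roles of (T, P) and (S, Q). *)
Section MoritaMaps.
Variables (T S : pzRingType) (P : bimodType T S) (Q : bimodType S T).
Variable h : bimodHom (tensor P Q : bimodType T T) (T^o : bimodType T T).

Section Maps.
Variable V : lmodType T.

Lemma pairing_alpha_linear (q : Q) (v : V) : linear (fun p => (h (tens p q) : T) *: v).
Proof.
move=> a x y; rewrite tensDl -scale_tens linearP scalerDl.
by rewrite -[a *: _ in LHS]/(a * _) scalerA.
Qed.

Lemma pairing_alpha_balanced :
  balanced (fun (q : Q) v => linear_of (pairing_alpha_linear q v)).
Proof.
split=> [q q' v|q v v'|q t v]; apply: linear_ext => p /=.
- by rewrite tensDr linearD scalerDl.
- by rewrite scalerDr.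
- rewrite scalerA; congr (_ *: _).
  by rewrite -tens_ract bimodHom_ract.
Qed.

(* q (x) v |-> [p |-> <p, q> v] *)
Definition pairing_alpha : {additive tensor Q V -> {linear P -> V}} :=
  tensor_additive pairing_alpha_balanced.

Lemma pairing_alpha_tens q v p :
  pairing_alpha (tens q v) p = (h (tens p q) : T) *: v.
Proof. by rewrite tensor_additive_tens. Qed.

Lemma pairing_eval_balanced :
  balanced (fun (p : P) (y : tensor Q V) => pairing_alpha y p).
Proof.
split=> [p p' y|p y y'|p s y]; first by rewrite linearD.
  by rewrite raddfD.
elim/tensor_ind: y => [q v||x y hx hy].
- by rewrite scale_tens !pairing_alpha_tens tensM.
- by rewrite scaler0 raddf0.
- rewrite scalerBr !raddfB.
  rewrite -[LHS]/(pairing_alpha x (p *> s) - pairing_alpha y (p *> s)).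
  by rewrite hx hy.
Qed.

Lemma pairing_eval_scale a (p : P) (y : tensor Q V) :
  pairing_alpha y (a *: p) = a *: pairing_alpha y p.
Proof. by rewrite linearZ. Qed.

(* The map with p (x) (q (x) v) |-> <p, q> v, cf. pairing_eval_tens. *)
Definition pairing_eval : {linear tensor P (tensor Q V) -> V} :=
  tensor_linear pairing_eval_balanced pairing_eval_scale.

Lemma pairing_eval_tens p q v :
  pairing_eval (tens p (tens q v)) = (h (tens p q) : T) *: v.
Proof. by rewrite tensor_linear_tens pairing_alpha_tens. Qed.
End Maps.

Lemma pairing_eval_natural (V V' : lmodType T) (f : {linear V -> V'}) :
  lin_comp (pairing_eval V') (tensor_map P (tensor_map Q f)) =
  lin_comp f (pairing_eval V).
Proof.
apply: tensor_linear_ext => p y.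
rewrite -[LHS]/(pairing_eval V' (tensor_map P (tensor_map Q f) (tens p y))).
rewrite -[RHS]/(f (pairing_eval V (tens p y))) tensor_map_tens.
elim/tensor_ind: y => [q v||x y hx hy].
- by rewrite tensor_map_tens !pairing_eval_tens linearZ.
- by rewrite linear0 !tens0 !linear0.
- by rewrite linearB !tensB !linearB hx hy.
Qed.

Definition pairing_natTrans :
    natTrans (compF (tensor_functor P) (tensor_functor Q)) (idF (lmod_category T)) :=
  @NatTrans _ _ (compF (tensor_functor P) (tensor_functor Q))
    (idF (lmod_category T)) pairing_eval pairing_eval_natural.
End MoritaMaps.

Definition right_alpha_condition (T S : pzRingType) (M : moritaContext T S) :=
  (forall U : lmodType T, injective (pairing_alpha (pairT M) U)) /\
  (forall U : lmodType S, injective (pairing_alpha (pairS M) U)).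

Section InducedContext.
Variables (T S : pzRingType) (M : moritaContext T S).
Local Notation P := (mP M).
Local Notation Q := (mQ M).

Lemma induced_etaP (X : lmodType T) :
  tensor_map Q (pairing_eval (pairT M) X) = pairing_eval (pairS M) (tensor Q X).
Proof.
apply: tensor_linear_ext => q y; rewrite tensor_map_tens.
elim/tensor_ind: y => [p z||x y hx hy].
- elim/tensor_ind: z => [q' x||x y hx hy].
  + by rewrite !pairing_eval_tens scale_tens pairSP tensM.
  + by rewrite !tens0 !linear0 tens0.
  + by rewrite !tensB !linearB tensB hx hy.
- by rewrite !tens0 !linear0 tens0.
- by rewrite !tensB !linearB tensB hx hy.
Qed.

Lemma induced_rhoP (Y : lmodType S) :
  tensor_map P (pairing_eval (pairS M) Y) = pairing_eval (pairT M) (tensor P Y).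
Proof.
apply: tensor_linear_ext => q y; rewrite tensor_map_tens.
elim/tensor_ind: y => [p z||x y hx hy].
- elim/tensor_ind: z => [q' x||x y hx hy].
  + by rewrite !pairing_eval_tens scale_tens -pairTP tensM.
  + by rewrite !tens0 !linear0 tens0.
  + by rewrite !tensB !linearB tensB hx hy.
- by rewrite !tens0 !linear0 tens0.
- by rewrite !tensB !linearB tensB hx hy.
Qed.

Definition induced_rightWideMoritaContext :
    rightWideMoritaContext (lmod_category T) (lmod_category S) :=
  @RightWideMoritaContext (lmod_category T) (lmod_category S)
    (tensor_functor Q) (tensor_functor P)
    (tensor_right_exact Q) (tensor_right_exact P)
    (pairing_natTrans (pairT M)) (pairing_natTrans (pairS M))
    induced_etaP induced_rhoP.
End InducedContext.

(* Main.v *)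
Require Import Defs.
From mathcomp Require Import all_boot all_algebra.
Import GRing.Theory.

Set Implicit Arguments.
Unset Strict Implicit.
Unset Printing Implicit Defensive.

Local Open Scope ring_scope.

(** For (1), the pairing [P (x) Q -> T] is [eta_T] precomposed with
    [P (x) Q ~ P (x) (Q (x) T)].  For (2), write [alpha] for the map of the
    alpha-condition at the module [Q (x) V].  The compatibility of the pairings
    gives [alpha x q = q (x) eta_V x] for [x] in [P (x) (Q (x) V)], so that
    [eta_V x = 0] forces [alpha x = 0], hence [x = 0]. *)

Lemma injective_monomorphism (R : pzRingType) (X Y : lmodType R)
    (f : {linear X -> Y}) :
  injective f -> @monomorphism (lmod_preadditive R) X Y f.
Proof.
move=> fI W h h' fh; apply: linear_ext => w; apply: fI.
exact: (lin_eq w fh).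
Qed.

Section TensorRegular.
Variables (R S : pzRingType) (P : bimodType R S).

Lemma ract_balanced : balanced (fun (p : P) (s : S^o) => p *> (s : S)).
Proof.
by split=> [p p' s|p s s'|p s s']; [exact: ractDl | exact: ractDr | rewrite -ractM].
Qed.

Lemma ract_scale a (p : P) (s : S^o) : (a *: p) *> (s : S) = a *: (p *> (s : S)).
Proof. by rewrite scale_ract. Qed.

(** With [tens1], this is the unit isomorphism between [P (x) S] and [P]. *)
Definition tensor_regular : {linear tensor P S^o -> P} :=
  tensor_linear ract_balanced ract_scale.

Lemma tens1_linear : linear (fun p : P => tens p (1 : S^o)).
Proof. by move=> a x y; rewrite tensDl scale_tens. Qed.

Definition tens1 : {linear P -> tensor P S^o} := linear_of tens1_linear.

Lemma tens1K : cancel tens1 tensor_regular.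
Proof. by move=> p; rewrite tensor_linear_tens ract1. Qed.
End TensorRegular.

Section Pairing.
Variables (T S : pzRingType) (P : bimodType T S) (Q : bimodType S T).
Variable hT : bimodHom (tensor P Q : bimodType T T) (T^o : bimodType T T).

(** On generators the value is [<p, q>] acting on the unit of [T^o], where the action is
    multiplication. *)
Lemma pairing_eval_tens1 (x : tensor P Q) :
  pairing_eval hT T^o (tensor_map P (tens1 Q) x) = hT x.
Proof.
elim/tensor_ind: x => [p q||x y hx hy]; rewrite ?linear0//.
  rewrite tensor_map_tens pairing_eval_tens.
  exact: mulr1.
by rewrite !linearB hx hy.
Qed.

(** Tensoring need not preserve injections, but it preserves split ones, and [tensor_regular Q] is a
    left inverse of [tens1 Q]. *)
Lemma tensor_map_tens1_inj : injective (tensor_map P (tens1 Q)).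
Proof.
apply: (can_inj (g := tensor_map P (tensor_regular Q))).
elim/tensor_ind => [p q||x y hx hy]; rewrite ?linear0//.
  by rewrite !tensor_map_tens tens1K.
by rewrite !linearB hx hy.
Qed.

Lemma pairing_inj : injective (pairing_eval hT T^o) -> injective hT.
Proof.
move=> eI x y; rewrite -!pairing_eval_tens1 => /eI.
exact: tensor_map_tens1_inj.
Qed.

Variable hS : bimodHom (tensor Q P : bimodType S S) (S^o : bimodType S S).
Hypothesis hSP : forall (q : Q) (p : P) (q' : Q),
  (hS (tens q p) : S) *: q' = q *> (hT (tens p q') : T).

(** On generators, [<q, p> q' (x) v = q <p, q'> (x) v = q (x) <p, q'> v]: compatibility moves the
    scalar to the right of [q], and balancing moves it across the tensor sign. *)
Lemma pairing_alpha_eval (V : lmodType T) (x : tensor P (tensor Q V)) q :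
  pairing_alpha hS (tensor Q V) x q = tens q (pairing_eval hT V x).
Proof.
elim/tensor_ind: x => [p y||x y hx hy].
- rewrite pairing_alpha_tens.
  elim/tensor_ind: y => [q' v||y z hy hz].
  + by rewrite pairing_eval_tens scale_tens hSP tensM.
  + by rewrite !tens0 scaler0 linear0 tens0.
  + by rewrite !tensB scalerBr linearB tensB hy hz.
- by rewrite raddf0 linear0 tens0.
(* What remains holds by conversion, as a difference of linear maps is evaluated pointwise. *)
- rewrite raddfB linearB tensB -hx -hy; reflexivity.
Qed.

Lemma pairing_eval_inj (V : lmodType T) :
  injective (pairing_alpha hS (tensor Q V)) -> injective (pairing_eval hT V).
Proof.
move=> aI x y exy; apply: aI; apply: linear_ext => q.
by rewrite !pairing_alpha_eval exy.
Qed.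
End Pairing.

Theorem theorem6p14 (T S : pzRingType) (M : moritaContext T S) :
  (injective_rightWideMoritaContext (induced_rightWideMoritaContext M) ->
   injective_moritaContext M) /\
  (right_alpha_condition M ->
   injective_rightWideMoritaContext (induced_rightWideMoritaContext M)).
Proof.
split=> [[etaM rhoM]|[aT aS]]; split.
- by apply: pairing_inj; apply: lmod_monic (etaM (T^o : lmodType T)).
- by apply: pairing_inj; apply: lmod_monic (rhoM (S^o : lmodType S)).
- move=> V; apply: injective_monomorphism.
  exact: (pairing_eval_inj (@pairSP _ _ M) (aS _)).
- move=> W; apply: injective_monomorphism.
  (* With [(T, P)] and [(S, Q)] exchanged, the required compatibility is the second one, read from
     right to left. *)
  apply: (pairing_eval_inj _ (aT _)) => p q p'.
  by rewrite pairTP.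
Qed.
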